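(* Let $(m_n)_{n\ge 2}$ be a sequence of positive integers, write $m=m_n$ and $p=p_n:=n^{-2}$, and for each $n$ let $X=(X_{ij})_{1\le i,j\le n}$ be a random matrix with joint multinomial distribution $\mathcal{M}(m,n^2)$. Assume that $$\frac{mp}{\log n}\to\infty \quad\text{as } n\to\infty.$$ Then, as $n\to\infty$, $$\mathbb{E}\max_{\sigma\in\mathcal{S}_n}\sum_{i=1}^n X_{i\sigma(i)}=\frac{m}{n}\,(1+o(1)),\qquad \mathbb{E}\min_{\sigma\in\mathcal{S}_n}\sum_{i=1}^n X_{i\sigma(i)}=\frac{m}{n}\,(1+o(1)).$$
   Context: $\mathcal{S}_n$ denotes the group of permutations of $\{1,\dots,n\}$. $\mathcal{M}(m,N)$ denotes the multinomial law with $m$ trials and $N$ equiprobable cells: it is the law of the vector of cell counts when $m$ particles are thrown independently and uniformly into $N$ cells. Under $\mathcal{M}(m,n^2)$ the cells are the $n^2$ positions $(i,j)$ of the matrix, so each $X_{ij}$ has the binomial distribution with $m$ trials and success probability $p=n^{-2}$, and $\sum_{i,j}X_{ij}=m$. *)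

(* Defs.v *)
From mathcomp Require Import all_boot all_order all_fingroup all_algebra.
From mathcomp Require Import all_classical all_reals all_analysis.

Set Implicit Arguments.
Unset Strict Implicit.
Unset Printing Implicit Defensive.

Import Order.TTheory GRing.Theory Num.Theory.
Import numFieldNormedType.Exports.

Local Open Scope classical_set_scope.
Local Open Scope ring_scope.

Definition cell_counts (m : nat) (C : finType) (f : {ffun 'I_m -> C}) :
    {ffun C -> nat} :=
  [ffun c => #|[set t | f t == c]%SET|].

(* A throw of [m] particles is a function [f] from particles to cells; the
   throws are independent and uniform exactly when all [#|C| ^ m] of them are
   equally likely. *)
Definition multinomial_pmf (R : realType) (m : nat) (C : finType)
    (k : {ffun C -> nat}) : R :=
  #|[set f : {ffun 'I_m -> C} | cell_counts f == k]%SET|%:R / (#|C| ^ m)%N%:R.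

(* The law of a vector indexed by the finite set [C] with entries in [nat] is
   discrete, hence determined by its point masses. *)
Definition has_multinomial_law (R : realType) (d : measure_display)
    (T : measurableType d) (P : probability T R) (m : nat) (C : finType)
    (Y : C -> {RV P >-> nat}) : Prop :=
  forall k : {ffun C -> nat},
    P [set w | forall c, Y c w = k c] = (multinomial_pmf R m k)%:E.

Definition perm_sum (n : nat) (x : 'I_n -> 'I_n -> nat) (s : 'S_n) : nat :=
  (\sum_(i < n) x i (s i))%N.

Definition max_perm_sum (n : nat) (x : 'I_n -> 'I_n -> nat) : nat :=
  (\max_(s : 'S_n) perm_sum x s)%N.

(* [minn] has no neutral element on [nat]; starting from the value at the
   identity permutation, itself in the range, leaves the minimum unchanged. *)
Definition min_perm_sum (n : nat) (x : 'I_n -> 'I_n -> nat) : nat :=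
  \big[minn/perm_sum x 1%g]_(s : 'S_n) perm_sum x s.

(* Main.v *)
Require Import Defs.
From mathcomp Require Import all_boot all_order all_fingroup all_algebra.
From mathcomp Require Import all_classical all_reals all_analysis.
From mathcomp Require Import measurable_realfun ring lra.

Import Order.TTheory GRing.Theory Num.Theory.
Import numFieldNormedType.Exports.

Local Open Scope classical_set_scope.
Local Open Scope ring_scope.

(** Write [mu = m / n ^ 2] for the mean of one cell. Any sum of [n] entries is
at most [n] times the largest of the [n ^ 2] cells and at least [n] times the
smallest one, so both claims follow once the extreme cells have mean
[mu * (1 + o(1))].

This is the exponential moment method. A binomial cell satisfies
[E expR (x * X_c) <= expR (mu * (expR x - 1))] for every real [x], of either
sign. Let [M] be the sum along a permutation that may depend on the matrix. Its
average [M / n] is dominated by one of the entries it involves, in the sense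
that [x * (M / n) <= x * X_c] for some cell [c]; hence [expR (x * M / n)] is
at most the sum of [expR (x * X_c)] over all cells, and Jensen's inequality gives
[x * E (M / n) <= ln (n ^ 2) + mu * (expR x - 1)] ([throw_mean_le_log]).
Taking [x = t] and [x = - t] with a small [t > 0] traps [E (M / n)] between
[mu * (1 - 4 * t)] and [mu * (1 + 4 * t)] as soon as [ln n <= t ^ 2 * mu], which
the hypothesis grants for all large [n] ([throw_mean_perm_sum]). Both the
maximum and the minimum are such sums [M], so the two-sided estimate applies to
each of them.

The law being discrete with finitely many atoms, expectations are first
rewritten as averages over all throws of the particles ([expectation_counts]),
where independence is the distributivity of a product over a sum. *)

(** * Averages over throws *)

(** Averaging over throws rather than over count vectors weighted by the
multinomial mass function keeps the particles visible as independent
factors. *)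
Definition throw_mean {R : realType} (m : nat) {C : finType}
    (g : {ffun C -> nat} -> R) : R :=
  (\sum_(f : {ffun 'I_m -> C}) g (cell_counts f)) / (#|C| ^ m)%:R.

Section Throws.
Context {R : realType} (m : nat) {C : finType} (hC : (0 < #|C|)%N).
Implicit Types g h : {ffun C -> nat} -> R.

Let N_gt0 : 0 < (#|C| ^ m)%:R :> R.
Proof. by rewrite ltr0n expn_gt0 hC. Qed.

Lemma throw_mean_cst (a : R) : throw_mean m (fun _ : {ffun C -> nat} => a) = a.
Proof.
rewrite /throw_mean sumr_const card_ffun card_ord -[a *+ _]mulr_natr mulfK//.
by rewrite gt_eqF.
Qed.

Lemma throw_meanD g h :
  throw_mean m (fun k => g k + h k) = throw_mean m g + throw_mean m h.
Proof. by rewrite /throw_mean big_split mulrDl. Qed.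

Lemma throw_meanZ (a : R) g :
  throw_mean m (fun k => a * g k) = a * throw_mean m g.
Proof. by rewrite /throw_mean -mulr_sumr mulrA. Qed.

Lemma throw_mean_le g h : (forall k, g k <= h k) ->
  throw_mean m g <= throw_mean m h.
Proof. by move=> gh; rewrite ler_pM2r ?invr_gt0// ler_sum. Qed.

Lemma throw_mean_sum (I : finType) (g : I -> {ffun C -> nat} -> R) :
  throw_mean m (fun k => \sum_i g i k) = \sum_i throw_mean m (g i).
Proof. by rewrite /throw_mean exchange_big/= mulr_suml. Qed.

(** The moment generating function of a binomial variable: the exponential of a
cell count is a product over the particles, and the sum over throws of such a
product factors. *)
Lemma throw_mean_expR_cell (x : R) (c : C) :
  throw_mean m (fun k : {ffun C -> nat} => expR (x * (k c)%:R)) =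
  (1 + (expR x - 1) / #|C|%:R) ^+ m.
Proof.
have N0 : #|C|%:R != 0 :> R by rewrite pnatr_eq0 -lt0n.
rewrite /throw_mean.
transitivity ((\prod_(t < m) \sum_(c' : C) (if c' == c then expR x else 1)) /
              (#|C| ^ m)%:R).
  congr (_ / _); rewrite bigA_distr_bigA; apply: eq_bigr => f _.
  rewrite -big_mkcond/= prodr_const mulrC expRM_natl /cell_counts ffunE.
  by congr (_ ^+ _); apply: eq_card => t; rewrite !inE.
rewrite prodr_const card_ord natrX -expr_div_n; congr (_ ^+ _).
rewrite (bigD1 c)//= eqxx (eq_bigr (fun=> 1)) => [|c' /negbTE->//].
have -> : \sum_(c' | c' != c) 1 = #|C|%:R - 1 :> R.
  have := sumr_const C (1 : R); rewrite (bigD1 c)//= => <-.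
  by rewrite addrC addrK.
by field.
Qed.

(** The binomial generating function is dominated by that of the Poisson law of
the same mean, because [1 + y <= expR y]. *)
Lemma throw_mean_expR_cell_le (x : R) (c : C) :
  throw_mean m (fun k : {ffun C -> nat} => expR (x * (k c)%:R)) <=
  expR (m%:R / #|C|%:R * (expR x - 1)).
Proof.
rewrite throw_mean_expR_cell -mulrA expRM_natl.
have N0 : 1 <= #|C|%:R :> R by rewrite (ler_nat _ 1).
apply: lerXn2r; rewrite ?nnegrE ?expR_ge0//; last first.
  by rewrite mulrC; exact: expR_ge1Dx.
have : 0 <= expR x / #|C|%:R by rewrite divr_ge0 ?expR_ge0.
have : #|C|%:R^-1 <= 1 :> R by rewrite invf_le1//; lra.
rewrite mulrBl mul1r; lra.
Qed.

(** The maximal inequality behind the theorem. The hypothesis on [g] bounds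
[expR (x * g k)] by the sum of [expR (x * k c)] over all cells, whose mean is at
most [expR a] for the right-hand side [a]. Jensen's inequality then gives
[x * E g <= a]; it is used in the form [1 + (x * g - a) <= expR (x * g - a)],
the tangent line of the exponential at [0]. Allowing [x] to be negative makes
the same statement control maxima from above and minima from below. *)
Lemma throw_mean_le_log (x : R) g :
  (forall k, exists c, x * g k <= x * (k c)%:R) ->
  x * throw_mean m g <= ln #|C|%:R + m%:R / #|C|%:R * (expR x - 1).
Proof.
move=> hg; set a := (X in _ <= X).
suff : throw_mean m (fun k => 1 + (x * g k + - a)) <= 1.
  by rewrite !throw_meanD throw_meanZ !throw_mean_cst; lra.
apply: (@le_trans _ _
    (throw_mean m (fun k : {ffun C -> nat} => expR (- a) * \sum_c expR (x * (k c)%:R)))).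
  apply: throw_mean_le => k; apply: (le_trans (expR_ge1Dx _)).
  rewrite expRD mulrC ler_wpM2l ?expR_ge0//.
  have [c hc] := hg k; rewrite (bigD1 c)//= -[leLHS]addr0 lerD ?ler_expR//.
  by apply: sumr_ge0 => *; exact: expR_ge0.
rewrite throw_meanZ throw_mean_sum.
apply: (@le_trans _ _ (expR (- a) *
    \sum_(c : C) expR (m%:R / #|C|%:R * (expR x - 1)))).
  rewrite ler_wpM2l ?expR_ge0// ler_sum// => c _.
  exact: throw_mean_expR_cell_le.
rewrite sumr_const -[X in _ * X]mulr_natl -[X in _ * (X * _)]lnK ?posrE ?ltr0n//.
by rewrite -!expRD addNr expR0.
Qed.

End Throws.

(** * Permutation sums *)

(** From [1 - x <= expR (- x)] one gets [expR x <= 1 / (1 - x)], and the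
geometric remainder [x ^ 2 / (1 - x)] is at most [2 * x ^ 2] when
[x <= 1 / 2]. *)
Lemma expR_le_quadratic {R : realType} (x : R) : `|x| <= 1 / 2 ->
  expR x - 1 <= x + 2 * x ^+ 2.
Proof.
rewrite ler_norml => /andP[x1 x2].
have h : (1 - x) * expR x <= expR (- x) * expR x.
  by rewrite ler_wpM2r ?expR_ge0 ?expR_ge1Dx.
rewrite -expRD addNr expR0 in h.
have e0 := expR_ge0 x.
nra.
Qed.

(** An average is at most its largest term and at least its smallest; the factor
[x], through its sign, says which of the two is meant. *)
Lemma perm_sum_entry {R : realType} {n : nat} (x : R) (a : 'I_n -> 'I_n -> nat)
    (s : 'S_n) : (0 < n)%N ->
  exists i, x * ((perm_sum a s)%:R / n%:R) <= x * (a i (s i))%:R.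
Proof.
move=> n0; apply: contrapT => /forallNP h.
have: \sum_(i < n) x * (a i (s i))%:R
    < \sum_(i < n) x * ((perm_sum a s)%:R / n%:R).
  apply: ltr_sum; first by apply/hasP; exists (Ordinal n0); rewrite ?mem_index_enum.
  by move=> i _; rewrite ltNge; apply/negP/h.
rewrite -mulr_sumr -natr_sum sumr_const card_ord -[X in _ < X]mulr_natr -!mulrA.
by rewrite mulVf ?mulr1 ?ltxx// pnatr_eq0 -lt0n.
Qed.

Lemma max_perm_sum_attained {n : nat} (a : 'I_n -> 'I_n -> nat) :
  exists s, max_perm_sum a = perm_sum a s.
Proof.
rewrite /max_perm_sum; have [|s ->] := @bigop.eq_bigmax _ (perm_sum a); last by exists s.
by apply/card_gt0P; exists 1%g.
Qed.

Lemma min_perm_sum_attained {n : nat} (a : 'I_n -> 'I_n -> nat) :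
  exists s, min_perm_sum a = perm_sum a s.
Proof.
apply: (big_ind (fun v => exists s, v = perm_sum a s)); first by exists 1%g.
- by move=> u v [s us] [t vt]; rewrite /minn; case: ifP; [exists s|exists t].
- by move=> s _; exists s.
Qed.

(** The maximum and the minimum share the property asked of [M], and the bounds
come from the exponential moments at [t] and at [- t]. The relative error
[4 * t] is the sum of [2 * t], from the quadratic term of the exponential, and
of a bound [2 * t] for [2 * ln n / (mu * t)], where [mu = m / n ^ 2]. *)
Lemma throw_mean_perm_sum {R : realType} (m n : nat)
    (M : ('I_n -> 'I_n -> nat) -> nat) (t : R) :
  (0 < n)%N -> (0 < m)%N -> (forall a, exists s, M a = perm_sum a s) ->
  0 < t <= 1 / 2 -> t^-2 <= m%:R * (n%:R ^+ 2)^-1 / ln n%:R ->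
  `|throw_mean m (fun k : {ffun 'I_n * 'I_n -> nat} =>
       (M (fun i j => k (i, j)))%:R) / (m%:R / n%:R) - 1| <= 4 * t.
Proof.
move=> n0 m0 hM /andP[t0 t1] hmu.
have nR0 : 0 < n%:R :> R by rewrite ltr0n.
have mR0 : 0 < m%:R :> R by rewrite ltr0n.
set mu := m%:R * (n%:R ^+ 2)^-1 in hmu *.
set g := fun k : {ffun 'I_n * 'I_n -> nat} => (M (fun i j => k (i, j)))%:R : R.
set L := ln n%:R in hmu *.
have mu0 : 0 < mu by rewrite mulr_gt0// invr_gt0 exprn_gt0.
have L0 : 0 <= L by rewrite ln_ge0// (ler_nat _ 1).
have Lmu : L <= mu * t ^+ 2.
  (* For n = 1 the logarithm vanishes, and so does the quotient by it, whereas
     t^-2 is positive. *)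
  have Lp : 0 < L.
    rewrite lt_neqAle L0 andbT; apply/eqP => L00; move: hmu.
    by rewrite -L00 invr0 mulr0 leNgt invr_gt0 exprn_gt0.
  by move: hmu; rewrite ler_pdivlMr// mulrC ler_pdivrMr ?exprn_gt0.
have hC : (0 < #|{: 'I_n * 'I_n}|)%N by rewrite card_prod card_ord muln_gt0 n0.
have key x : `|x| = t ->
    x * (throw_mean m g / n%:R) <= 2 * L + mu * (x + 2 * t ^+ 2).
  move=> xt.
  have := @throw_mean_le_log R m _ hC x (fun k => n%:R^-1 * g k).
  rewrite throw_meanZ [n%:R^-1 * _]mulrC.
  rewrite card_prod card_ord natrM lnM ?posrE// -expr2 -/mu -/L => h.
  apply: le_trans (h _) _.
    move=> k; have [s Ms] := hM (fun i j => k (i, j)).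
    have [i hi] := perm_sum_entry x (fun i j => k (i, j)) s n0.
    by exists (i, s i); rewrite /g Ms [n%:R^-1 * _]mulrC.
  rewrite -xt real_normK ?num_real// mulr2n mulrDl mul1r lerD2l ler_pM2l//.
  by apply: expR_le_quadratic; rewrite xt.
have -> : throw_mean m g / (m%:R / n%:R) = (throw_mean m g / n%:R) / mu.
  by rewrite /mu; field; rewrite !gt_eqF.
set E := throw_mean m g / n%:R in key *.
have kp := key t (gtr0_norm t0).
have kn := key (- t); rewrite normrN gtr0_norm// in kn.
have {}kn := kn erefl.
have hE1 : E <= mu * (1 + 4 * t) by rewrite -(ler_pM2l t0); nra.
have hE2 : mu * (1 - 4 * t) <= E by rewrite -(ler_pM2l t0); nra.
rewrite ler_norml lerBrDr lerBlDr ler_pdivlMr// ler_pdivrMr//.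
by apply/andP; split; lra.
Qed.

(** * From random vectors to throws *)

(** The atoms charged by the multinomial law are the count vectors of throws;
their masses add up to [1], so the integral is carried by these finitely many
events, and grouping the throws by their count vector turns the weighted sum of
values into an average over throws. *)
Lemma expectation_counts {R : realType} {d : measure_display}
    {T : measurableType d} {P : probability T R} (m : nat) {C : finType}
    (Y : C -> {RV P >-> nat}) (g : {ffun C -> nat} -> R) :
  (0 < #|C|)%N -> has_multinomial_law m Y -> (forall k, 0 <= g k) ->
  ('E_P[fun w => g [ffun c => Y c w]] = (throw_mean m g)%:E)%E.
Proof.
move=> hC hY g0; set Z := fun w => [ffun c => Y c w].
pose A (k : {ffun C -> nat}) := Z @^-1` [set k].
have AE k : A k = [set w | forall c, Y c w = k c].
  apply/seteqP; split => w /=; first by move=> <- c; rewrite ffunE.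
  by move=> h; apply/ffunP => c; rewrite ffunE.
have PA k : P (A k) = (multinomial_pmf R m k)%:E by rewrite AE hY.
have mA k : measurable (A k).
  have -> : A k = \bigcap_(c in [set: C]) Y c @^-1` [set k c].
    by rewrite AE; apply/seteqP; split => w h c; [move=> _|]; exact: h.
  apply: fin_bigcap_measurable => // c _; exact: measurable_funPTI.
(* The space of count vectors is countable, so every function of the vector is
   measurable. *)
have mZ (B : set {ffun C -> nat}) : measurable (Z @^-1` B).
  have -> : Z @^-1` B = \bigcup_(k in [set: {ffun C -> nat}]) (if k \in B then A k else set0).
    apply/seteqP; split => w /=; first by exists (Z w) => //; rewrite mem_set.
    by case=> k _; case: ifPn => // /set_mem Bk; rewrite /A /= => ->.
  apply: countable_bigcupT_measurable => // k; by case: ifP.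
pose G : T -> R := g \o Z.
have mG : measurable_fun setT G.
  by move=> _ B _; rewrite setTI; exact: (mZ (g @^-1` B)).
have /measurable_EFinP mg := mG.
pose s : seq {ffun C -> nat} := undup (codom (@cell_counts m C)).
have sP (f : {ffun 'I_m -> C}) : cell_counts f \in s.
  by rewrite mem_undup; apply/codomP; exists f.
have count_sum (h : {ffun C -> nat} -> R) :
    \sum_(k <- s) h k * multinomial_pmf R m k = throw_mean m h.
  rewrite /throw_mean mulr_suml.
  transitivity (\sum_(k <- s) \sum_(f : {ffun 'I_m -> C} | cell_counts f == k)
      h (cell_counts f) / (#|C| ^ m)%:R).
    apply: eq_bigr => k _.
    rewrite (eq_bigr (fun=> h k / (#|C| ^ m)%:R)) => [|f /eqP->//].
    rewrite sumr_const /multinomial_pmf -[RHS]mulr_natr -mulrA [_ / _ in LHS]mulrC.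
    by congr (_ * (_ * _%:R)); apply: eq_card => f; rewrite !inE.
  rewrite (exchange_big_dep xpredT)//=; apply: eq_bigr => f _.
  rewrite big_mkcond (bigD1_seq (cell_counts f)) ?undup_uniq//= eqxx big1 ?addr0//.
  by move=> k; rewrite eq_sym => /negbTE->.
pose D := \big[setU/set0]_(k <- s) A k.
have mD : measurable D by exact: bigsetU_measurable.
have tA : trivIset [set` s] A by exact: trivIset_preimage1.
have PD : P D = 1%E.
  rewrite /D -bigcup_seq measure_fin_bigcup//.
  rewrite -fsbig_seq ?undup_uniq//.
  rewrite (eq_bigr (fun k => (multinomial_pmf R m k)%:E)); last first.
    by move=> k _; exact: PA.
  rewrite sumEFin; congr EFin.
  rewrite -[RHS](throw_mean_cst m hC) -count_sum.
  by apply: eq_bigr => k _; rewrite mul1r.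
(* The complement of D is a null set. *)
rewrite unlock -(setUv D) ge0_integral_setU//; last 4 first.
- exact: measurableC.
- by rewrite setUv.
- by move=> w _; rewrite lee_fin.
- exact/disj_setPCl.
rewrite [X in (_ + X)%E]null_set_integral ?adde0; last 3 first.
- exact: measurableC.
- exact: measurable_funTS.
- by have := probability_setC P mD; rewrite PD subee.
rewrite ge0_integral_bigsetU ?undup_uniq//; last 2 first.
- exact: measurable_funTS.
- by move=> w _; rewrite lee_fin.
rewrite -count_sum -sumEFin; apply: eq_bigr => k _.
rewrite EFinM -PA -integral_cst//; apply: eq_integral => w.
by rewrite inE /A/= /Z => ->.
Qed.

(** * The asymptotics *)

(** Each fixed small [t] is admissible in the two-sided estimate for all large
[n], and the relative error is then at most [4 * t]; hence it tends to [0]. *)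
Lemma expectation_selected_perm_sum {R : realType} (m : nat -> nat)
    (d : nat -> measure_display) (T : forall n : nat, measurableType (d n))
    (P : forall n : nat, probability (T n) R)
    (X : forall n : nat, 'I_n -> 'I_n -> {RV (P n) >-> nat})
    (M : forall n, ('I_n -> 'I_n -> nat) -> nat) :
  (forall n, (2 <= n)%N -> (0 < m n)%N) ->
  (forall n, (2 <= n)%N ->
     has_multinomial_law (m n) (fun c : 'I_n * 'I_n => X n c.1 c.2)) ->
  (m n)%:R * (n%:R ^+ 2)^-1 / ln (n%:R : R) @[n --> \oo] --> +oo ->
  (forall n a, exists s, M n a = perm_sum a s) ->
  exists2 eps : nat -> R, eps n @[n --> \oo] --> (0 : R) &
    forall n : nat, (2 <= n)%N ->
      ('E_(P n)[fun w => (M n (fun i j => X n i j w))%:R] =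
         ((m n)%:R / n%:R * (1 + eps n))%:E)%E.
Proof.
move=> hm hX hmp hM.
pose g n (k : {ffun 'I_n * 'I_n -> nat}) : R := (M n (fun i j => k (i, j)))%:R.
exists (fun n => throw_mean (m n) (g n) / ((m n)%:R / n%:R) - 1).
  apply/cvgr0Pnorm_le => e e0; pose t : R := Num.min (e / 4) (1 / 2).
  have t0 : 0 < t by rewrite lt_min; apply/andP; split; lra.
  have te : t <= e / 4 by rewrite ge_min lexx.
  have t1 : t <= 1 / 2 by rewrite ge_min lexx orbT.
  have ht : \forall n \near \oo, t^-2 <= (m n)%:R * (n%:R ^+ 2)^-1 / ln (n%:R : R).
    by move/cvgryPge : hmp; exact.
  near=> n.
  have n2 : (2 <= n)%N by near: n; exists 2%N.
  have tt : 0 < t <= 1 / 2 by rewrite t0.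
  have tn : t^-2 <= (m n)%:R * (n%:R ^+ 2)^-1 / ln (n%:R : R) by near: n.
  apply: le_trans (throw_mean_perm_sum (m n) n (M n) t _ (hm n n2) (hM n) tt tn) _.
    exact: ltnW.
  lra.
move=> n n2.
have n0 : (0 < n)%N by exact: ltnW.
have mn0 : (m n)%:R / n%:R != 0 :> R.
  by rewrite gt_eqF// divr_gt0// ltr0n// hm.
have hC : (0 < #|{: 'I_n * 'I_n}|)%N by rewrite card_prod card_ord muln_gt0 n0.
have -> : (fun w => (M n (fun i j => X n i j w))%:R) =
    (fun w => g n [ffun c : 'I_n * 'I_n => X n c.1 c.2 w]).
  apply/funext => w; congr (M n _)%:R.
  by apply/funext => i; apply/funext => j; rewrite ffunE.
rewrite (expectation_counts (m n) _ (g n) hC (hX n n2)) => [|k]; last exact: ler0n.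
by rewrite addrC subrK mulrC divfK.
Unshelve. all: by end_near.
Qed.

Theorem theorem1 (R : realType) (m : nat -> nat)
    (d : nat -> measure_display) (T : forall n : nat, measurableType (d n))
    (P : forall n : nat, probability (T n) R)
    (X : forall n : nat, 'I_n -> 'I_n -> {RV (P n) >-> nat})
    (p : nat -> R)
    (hp : forall n : nat, p n = (n%:R ^+ 2)^-1)
    (hm : forall n : nat, (2 <= n)%N -> (0 < m n)%N)
    (hX : forall n : nat, (2 <= n)%N ->
      has_multinomial_law (m n) (fun c : 'I_n * 'I_n => X n c.1 c.2))
    (hmp : (m n)%:R * p n / ln (n%:R : R) @[n --> \oo] --> +oo) :
  (exists2 eps : nat -> R, eps n @[n --> \oo] --> (0 : R) &
    forall n : nat, (2 <= n)%N ->
      ('E_(P n)[fun w => (max_perm_sum (fun i j => X n i j w))%:R] =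
         ((m n)%:R / n%:R * (1 + eps n))%:E)%E) /\
  (exists2 eps : nat -> R, eps n @[n --> \oo] --> (0 : R) &
    forall n : nat, (2 <= n)%N ->
      ('E_(P n)[fun w => (min_perm_sum (fun i j => X n i j w))%:R] =
         ((m n)%:R / n%:R * (1 + eps n))%:E)%E).
Proof.
have hmp' : (m n)%:R * (n%:R ^+ 2)^-1 / ln (n%:R : R) @[n --> \oo] --> +oo.
  by under eq_fun do rewrite -hp.
split.
- exact: (expectation_selected_perm_sum m d T P X (@max_perm_sum) hm hX hmp'
    (@max_perm_sum_attained)).
- exact: (expectation_selected_perm_sum m d T P X (@min_perm_sum) hm hX hmp'
    (@min_perm_sum_attained)).
Qed.
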